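(* For every integer $n\ge0$, $3\mid s(n)$ if and only if $n\in A_3$.
   Context: The Stern sequence $(s(n))_{n\ge0}$ is defined by $s(0)=0$, $s(1)=1$, $s(2n)=s(n)$, $s(2n+1)=s(n)+s(n+1)$. The set $A_3\subset\mathbb N$ is defined recursively as the smallest set such that $0,5,7\in A_3$, and whenever $0<n\in A_3$, also $2n,\ 8n+5,\ 8n-5,\ 8n+7,\ 8n-7\in A_3$. *)

(* Defs.v *)
From mathcomp Require Import all_boot zify.

Set Implicit Arguments.
Unset Strict Implicit.
Unset Printing Implicit Defensive.

(* The first argument only bounds the recursion depth; any k >= n gives the
   same value.  The recurrence that characterises the Stern sequence is given by
   stern0, stern1, stern_even and stern_odd, and sternP shows that it determines
   the sequence. *)
Fixpoint stern_rec (k n : nat) : nat :=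
  if k is k'.+1 then
    if n <= 1 then n
    else if odd n then stern_rec k' n./2 + stern_rec k' (n./2).+1
    else stern_rec k' n./2
  else 0.

Definition stern (n : nat) : nat := stern_rec n n.

Lemma stern_rec_fuel k n : n <= k -> stern_rec k n = stern n.
Proof.
have [m] := ubnP n; elim: m n k => // m IHm n k lenm.
case: k => [|k]; first by rewrite leqn0 => /eqP->.
case: n lenm => [|n] // lenm lenk.
rewrite /stern /stern_rec -/stern_rec.
case: ifP => // n_gt1.
by case: ifP => odn; rewrite !(IHm _ k) ?(IHm _ n) //; lia.
Qed.

Lemma stern0 : stern 0 = 0. Proof. by []. Qed.

Lemma stern1 : stern 1 = 1. Proof. by []. Qed.

Lemma stern_unfold n : 1 < n ->
  stern n = if odd n then stern n./2 + stern (n./2).+1 else stern n./2.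
Proof.
case: n => [|n] // n_gt1; rewrite {1}/stern /stern_rec -/stern_rec leqNgt n_gt1.
by case: ifP => odn; rewrite /= !stern_rec_fuel //; lia.
Qed.

Lemma stern_even n : stern (2 * n) = stern n.
Proof.
case: n => [|n] //; rewrite stern_unfold; last by lia.
by rewrite mul2n odd_double doubleK.
Qed.

Lemma stern_odd n : stern (2 * n + 1) = stern n + stern n.+1.
Proof.
case: n => [|n] //; rewrite stern_unfold; last by lia.
have -> : (2 * n.+1 + 1)./2 = n.+1 by lia.
by rewrite addn1 mul2n /= odd_double.
Qed.

Lemma sternP (s : nat -> nat) :
    s 0 = 0 -> s 1 = 1 ->
    (forall n, s (2 * n) = s n) ->
    (forall n, s (2 * n + 1) = s n + s n.+1) ->
  s =1 stern.
Proof.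
move=> s0 s1 se so n; have [m] := ubnP n; elim: m n => // m IHm n lenm.
case: (leqP n 1) => [|n_gt1]; first by case: n lenm => [|[|n]].
rewrite -(odd_double_half n) -mul2n addnC.
case on: (odd n); last by rewrite addn0 se stern_even IHm //; lia.
by rewrite so stern_odd !IHm //; lia.
Qed.

(* For n > 0 the differences below are positive, so truncated subtraction on nat
   agrees with subtraction on the integers. *)
Inductive A3 : nat -> Prop :=
| A3_0 : A3 0
| A3_5 : A3 5
| A3_7 : A3 7
| A3_double n : 0 < n -> A3 n -> A3 (2 * n)
| A3_add5 n : 0 < n -> A3 n -> A3 (8 * n + 5)
| A3_sub5 n : 0 < n -> A3 n -> A3 (8 * n - 5)
| A3_add7 n : 0 < n -> A3 n -> A3 (8 * n + 7)
| A3_sub7 n : 0 < n -> A3 n -> A3 (8 * n - 7).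

(* Main.v *)
(* Modulo 3, each odd residue class mod 8 forgets one of s(m), s(m+1):
   s(8m+1) = s(m+1), s(8m+3) = 2 s(m+1), s(8m+5) = 2 s(m), s(8m+7) = s(m).
   So divisibility of s(n) by 3 reduces to that of s(m) or s(m+1), following
   exactly the rules that generate A3. *)
Require Import Defs.
From mathcomp Require Import all_boot zify.

Lemma stern_2addS n : stern (2 * n).+1 = stern n + stern n.+1.
Proof. by rewrite -addn1 stern_odd. Qed.

(** This and the next three identities are the odd cases of [s(8m+r) = s(8-r) s(m) + s(r) s(m+1)],
    obtained by unfolding the three low binary digits. The modulus 8 is the least power of 2 for
    which every odd [r] makes one coefficient equal to 3. *)
Lemma stern_8add1 m : stern (8 * m + 1) = 3 * stern m + stern m.+1.
Proof.
have -> : 8 * m + 1 = 2 * (2 * (2 * m)) + 1 by lia.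
by rewrite stern_odd !stern_2addS !stern_even; lia.
Qed.

Lemma stern_8add3 m : stern (8 * m + 3) = 3 * stern m + 2 * stern m.+1.
Proof.
have -> : 8 * m + 3 = 2 * (2 * (2 * m) + 1) + 1 by lia.
rewrite stern_odd.
have -> : (2 * (2 * m) + 1).+1 = 2 * (2 * m + 1) by lia.
by rewrite stern_even !stern_odd stern_2addS stern_even; lia.
Qed.

Lemma stern_8add5 m : stern (8 * m + 5) = 2 * stern m + 3 * stern m.+1.
Proof.
have -> : 8 * m + 5 = 2 * (2 * (2 * m + 1)) + 1 by lia.
rewrite stern_odd stern_even stern_2addS !stern_odd.
have -> : (2 * m + 1).+1 = 2 * m.+1 by lia.
by rewrite stern_even; lia.
Qed.

Lemma stern_8add7 m : stern (8 * m + 7) = stern m + 3 * stern m.+1.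
Proof.
have -> : 8 * m + 7 = 2 * (2 * (2 * m + 1) + 1) + 1 by lia.
rewrite !stern_odd.
have -> : (2 * (2 * m + 1) + 1).+1 = 2 * (2 * m.+1) by lia.
have -> : (2 * m + 1).+1 = 2 * m.+1 by lia.
by rewrite !stern_even; lia.
Qed.

Lemma dvd3_stern_8add1 m : (3 %| stern (8 * m + 1)) = (3 %| stern m.+1).
Proof. by rewrite stern_8add1 dvdn_addr // dvdn_mulr. Qed.

Lemma dvd3_stern_8add3 m : (3 %| stern (8 * m + 3)) = (3 %| stern m.+1).
Proof. by rewrite stern_8add3 dvdn_addr; [rewrite Gauss_dvdr | rewrite dvdn_mulr]. Qed.

Lemma dvd3_stern_8add5 m : (3 %| stern (8 * m + 5)) = (3 %| stern m).
Proof. by rewrite stern_8add5 dvdn_addl; [rewrite Gauss_dvdr | rewrite dvdn_mulr]. Qed.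

Lemma dvd3_stern_8add7 m : (3 %| stern (8 * m + 7)) = (3 %| stern m).
Proof. by rewrite stern_8add7 dvdn_addl // dvdn_mulr. Qed.

Lemma A3_dvd3_stern n : A3 n -> 3 %| stern n.
Proof.
elim=> // {}n n_gt0 _ dvd3.
- by rewrite stern_even.
- by rewrite dvd3_stern_8add5.
(* A subtractive rule is a residue class based at [n - 1], whose surviving term [s(m+1)] is then
   [s(n)]. *)
- have -> : 8 * n - 5 = 8 * n.-1 + 3 by lia.
  by rewrite dvd3_stern_8add3 prednK.
- by rewrite dvd3_stern_8add7.
- have -> : 8 * n - 7 = 8 * n.-1 + 1 by lia.
  by rewrite dvd3_stern_8add1 prednK.
Qed.

Lemma dvd3_stern_A3 n : 3 %| stern n -> A3 n.
Proof.
have [k] := ubnP n; elim: k n => // k IHk n ltnk.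
have [->|n_gt0] := posnP n; first by move=> _; exact: A3_0.
case on: (odd n); last first.
  have -> : n = 2 * n./2 by lia.
  by rewrite stern_even => dvd3; apply: A3_double; [lia | apply: IHk => //; lia].
pose m := n %/ 8.
have : n = 8 * m + 1 \/ n = 8 * m + 3 \/ n = 8 * m + 5 \/ n = 8 * m + 7 by lia.
case=> [def_n|[def_n|[def_n|def_n]]]; rewrite def_n.
(* For [m = 0] the descent from [8m+1] to [m+1] would stall at 1, but [s(1) = 1] contradicts
   divisibility. *)
- have [m0|m_gt0] := posnP m; first by rewrite m0.
  rewrite dvd3_stern_8add1 => dvd3.
  have -> : 8 * m + 1 = 8 * m.+1 - 7 by lia.
  by apply: A3_sub7 => //; apply: IHk => //; lia.
(* Here [m+1 < 8m+3] even when [m = 0], so the descent is always strict. *)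
- rewrite dvd3_stern_8add3 => dvd3.
  have -> : 8 * m + 3 = 8 * m.+1 - 5 by lia.
  by apply: A3_sub5 => //; apply: IHk => //; lia.
(* The additive rules start from a positive [m]; since [s(0) = 0], the case [m = 0] yields the seeds
   5 and, below, 7. *)
- have [m0|m_gt0] := posnP m; first by rewrite m0 => _; exact: A3_5.
  rewrite dvd3_stern_8add5 => dvd3.
  by apply: A3_add5 => //; apply: IHk => //; lia.
- have [m0|m_gt0] := posnP m; first by rewrite m0 => _; exact: A3_7.
  rewrite dvd3_stern_8add7 => dvd3.
  by apply: A3_add7 => //; apply: IHk => //; lia.
Qed.

Theorem theorem5p1 (n : nat) : 3 %| stern n <-> A3 n.
Proof. by split; [exact: dvd3_stern_A3 | exact: A3_dvd3_stern]. Qed.
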